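(* Let $G=(\mathcal{V},\mathcal{E})$ be a finite simple undirected graph with a clique cover $\{\mathcal{C}^\star_l\}_{l=1}^{k^\star}$, and suppose that $G$ satisfies the $c$-SCC property with respect to this clique cover for some $$c<\min\left\{\frac14\left(\frac{\min_l 1/|\mathcal{C}^\star_l|}{\sum_{l}1/|\mathcal{C}^\star_l|}\right)^2,\ \frac1{100}\right\}.$$ Then $(A^\star,k^\star)$ (that is, $A=A^\star$, $t=k^\star$) is the unique optimal solution of the Lovász theta program (P) of $G$.
   Context: A clique cover of $G$ is a partition of $\mathcal{V}$ into nonempty sets $\mathcal{C}^\star_1,\dots,\mathcal{C}^\star_{k^\star}$ each of which is a clique in $G$ (all pairs of distinct vertices are adjacent). $c$-SCC ($c$-sparse clique cover) property: for every vertex $v$ and every clique $\mathcal{C}^\star_l$ that does not contain $v$, the number of edges of $G$ joining $v$ to vertices of $\mathcal{C}^\star_l$ is at most $c|\mathcal{C}^\star_l|$. Lovász theta program (P) of $G$: minimize $t$ over pairs $(t,A)$ with $t\in\mathbb{R}$ and $A$ a real symmetric $|\mathcal{V}|\times|\mathcal{V}|$ matrix, subject to $tI+A-J\succeq 0$, $A_{i,i}=0$ for all $i$, and $A_{i,j}=0$ for all $(i,j)\notin\mathcal{E}$. Here $J$ is the all-ones matrix and $I$ the identity matrix. $A^\star := \sum_{l=1}^{k^\star} k^\star\,\mathbf{1}_{\mathcal{C}^\star_l}\mathbf{1}_{\mathcal{C}^\star_l}^T-k^\star I$, where $\mathbf{1}_{\mathcal{C}}\in\mathbb{R}^{|\mathcal{V}|}$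 is the 0/1 indicator vector of $\mathcal{C}\subset\mathcal{V}$. *)

(* Defs.v *)
From HB Require Import structures.
From mathcomp Require Import all_boot all_order all_algebra.
From mathcomp Require Import reals.

Set Implicit Arguments.
Unset Strict Implicit.
Unset Printing Implicit Defensive.

Import Order.TTheory GRing.Theory Num.Theory.

Local Open Scope ring_scope.

Definition simple_graph (V : finType) (e : rel V) : Prop :=
  symmetric e /\ irreflexive e.

Definition is_clique (V : finType) (e : rel V) (C : {set V}) : Prop :=
  {in C &, forall u v, u != v -> e u v}.

(* [partition] already requires the blocks to be nonempty. *)
Definition clique_cover (V : finType) (e : rel V) (P : {set {set V}}) : Prop :=
  partition P [set: V] /\ {in P, forall C, is_clique e C}.

Definition SCC (R : realType) (V : finType) (e : rel V) (P : {set {set V}})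
    (c : R) : Prop :=
  forall (v : V) (C : {set V}), C \in P -> v \notin C ->
    #|[set u in C | e v u]|%:R <= c * #|C|%:R.

(* The default value 1 of the iterated minimum is harmless when [P] is a
   nonempty family of nonempty sets, since then every term is at most 1. *)
Definition min_inv_card (R : realType) (V : finType) (P : {set {set V}}) : R :=
  \big[Num.min/1]_(C in P) (#|C|%:R)^-1.

Definition sum_inv_card (R : realType) (V : finType) (P : {set {set V}}) : R :=
  \sum_(C in P) (#|C|%:R)^-1.

Definition psdmx (R : realType) (n : nat) (M : 'M[R]_n) : Prop :=
  M^T = M /\ forall x : 'cV[R]_n, 0 <= (x^T *m M *m x) 0 0.

(* Rows and columns are indexed by V through its enumeration: the index i
   stands for the vertex [enum_val i]. *)
Definition theta_feasible (R : realType) (V : finType) (e : rel V)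
    (t : R) (A : 'M[R]_#|V|) : Prop :=
  [/\ A^T = A,
      psdmx (t%:M + A - const_mx 1),
      forall i, A i i = 0
    & forall i j, ~~ e (enum_val i) (enum_val j) -> A i j = 0].

Definition theta_optimal (R : realType) (V : finType) (e : rel V)
    (t : R) (A : 'M[R]_#|V|) : Prop :=
  theta_feasible e t A /\
  forall (t' : R) (A' : 'M[R]_#|V|), theta_feasible e t' A' -> t <= t'.

Definition indic (R : realType) (V : finType) (C : {set V}) : 'cV[R]_#|V| :=
  \col_i (enum_val i \in C)%:R.

Definition Astar (R : realType) (V : finType) (P : {set {set V}}) :
    'M[R]_#|V| :=
  (\sum_(C in P) #|P|%:R *: (indic R C *m (indic R C)^T)) - (#|P|%:R)%:M.

(* Main.v *)
Require Import Defs.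
From mathcomp Require Import all_boot all_order all_algebra.
From mathcomp Require Import reals.
From mathcomp Require Import ring lra.
Import Order.TTheory GRing.Theory Num.Theory.
Local Open Scope ring_scope.

(** Let [(t, A)] be feasible, [M = tI + A - J], [k] the number of cliques and
    [n_v] the size of the clique of [v].  For [i, i'] in one clique, the form
    [M] at [e_i - e_i'] is [g(i,i') = 2 t - 2 A_ii' >= 0] (if [i <> i']).
    For a cross edge [ij] and [i', j'] in the cliques of [i, j] such that
    [ij', i'j, i'j'] are not edges, the form at
    [(e_i - e_i') +- (e_j - e_j')] gives [|A_ij| <= (g(i,i') + g(j,j')) / 2].
    By sparsity all but a proportion [3c] of the pairs [(i', j')] qualify, so
    averaging bounds [|A_ij|] by averages of [g].  Finally the form at
    [u = sum_v e_v / n_v] reads [0 <= t k - k^2 - T / 2 + X], where [T] is a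
    positive combination of all the [g(i,i')] and the cross term [X] is at most
    [c k T / (1 - 3c)].  As [c k <= 1/4] this yields [T / 5 <= k (t - k)], hence
    [k <= t]; when [t = k] every [g(i,i')] vanishes, which determines [A]. *)

Set Implicit Arguments.
Unset Strict Implicit.

(** * Bilinear forms indexed by vertices, and their matrix counterparts *)

Section BilinearForm.
Context {R : realType} {V : finType}.
Implicit Types (M : V -> V -> R) (x y : V -> R).

Definition bform M x y : R := \sum_u \sum_v x u * M u v * y v.

Definition dirac_diff (i j : V) : V -> R := fun u => (u == i)%:R - (u == j)%:R.

Lemma bform_line M x y s :
  bform M (fun u => x u + s * y u) (fun u => x u + s * y u) =
  bform M x x + s * (bform M x y + bform M y x) + s ^+ 2 * bform M y y.
Proof.
rewrite /bform !(mulrDr, mulr_sumr) -!big_split; apply: eq_bigr => u _ /=.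
rewrite !mulr_sumr -!big_split; apply: eq_bigr => v _ /=; ring.
Qed.

Lemma sum_dirac_diff (f : V -> R) i j :
  \sum_u f u * dirac_diff i j u = f i - f j.
Proof.
rewrite /dirac_diff; under eq_bigr do rewrite mulrBr.
have sum_eq k : \sum_u f u * (u == k)%:R = f k.
  rewrite (bigD1 k) //= eqxx mulr1 big1 ?addr0 // => u /negPf ->.
  by rewrite mulr0.
by rewrite sumrB !sum_eq.
Qed.

Lemma bform_dirac_diff M i i' j j' :
  bform M (dirac_diff i i') (dirac_diff j j') =
  M i j - M i j' - (M i' j - M i' j').
Proof.
rewrite /bform -(sum_dirac_diff (fun u => M u j - M u j')).
apply: eq_bigr => u _; rewrite -(sum_dirac_diff (M u)) mulr_suml.
by apply: eq_bigr => v _; ring.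
Qed.

Lemma mulmx_bformE (M : 'M[R]_#|V|) (x : 'cV[R]_#|V|) :
  (x^T *m M *m x) 0 0 =
  bform (fun u v => M (enum_rank u) (enum_rank v))
        (fun u => x (enum_rank u) 0) (fun u => x (enum_rank u) 0).
Proof.
rewrite /bform exchange_big mxE (reindex enum_rank) /=; last first.
  exact/onW_bij/enum_rank_bij.
apply: eq_bigr => v _; rewrite mxE (reindex enum_rank) /=; last first.
  exact/onW_bij/enum_rank_bij.
by rewrite mulr_suml; apply: eq_bigr => u _; rewrite mxE.
Qed.

Lemma theta_mxE (t : R) (A : 'M[R]_#|V|) i j :
  (t%:M + A - const_mx 1) (enum_rank i) (enum_rank j) =
  t * (i == j)%:R + A (enum_rank i) (enum_rank j) - 1.
Proof. by rewrite !mxE (inj_eq enum_rank_inj) mulr_natr. Qed.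

Lemma psdmx_bform_ge0 (M : 'M[R]_#|V|) (x : V -> R) :
  psdmx M -> 0 <= bform (fun u v => M (enum_rank u) (enum_rank v)) x x.
Proof.
move=> [_ /(_ (\col_i x (enum_val i)))]; rewrite mulmx_bformE /bform.
by under eq_bigr do under eq_bigr do rewrite !mxE !enum_rankK.
Qed.

End BilinearForm.

(** * Blocks of the cover and inverse block sizes *)

Section Cover.
Context {R : realType} {V : finType} (P : {set {set V}}).
Hypothesis partP : partition P [set: V].

Let coverE : cover P = setT. Proof. exact: cover_partition. Qed.
Let triv : trivIset P. Proof. exact: partition_trivIset partP. Qed.

Let pb_mem v : pblock P v \in P.
Proof. by rewrite pblock_mem // coverE inE. Qed.

(** This is the test vector [u] of the overview: its entries sum to 1 over every block. *)
Definition block_weight (v : V) : R := #|pblock P v|%:R^-1.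

Lemma block_card_gt0 (C : {set V}) : C \in P -> 0 < #|C|%:R :> R.
Proof.
move=> CP; rewrite ltr0n card_gt0; apply: contraTneq CP => ->.
by case/and3P: partP.
Qed.

Lemma block_weight_gt0 v : 0 < block_weight v.
Proof. by rewrite invr_gt0 block_card_gt0. Qed.

Lemma card_block_weight v : #|pblock P v|%:R * block_weight v = 1.
Proof. by rewrite mulfV // gt_eqF // block_card_gt0. Qed.

Lemma sum_blocks (F : V -> R) :
  \sum_v F v = \sum_(C in P) \sum_(v in C) F v.
Proof.
rewrite -big_trivIset //= coverE.
by apply: eq_bigl => v; rewrite inE.
Qed.

Lemma block_weightE C v : C \in P -> v \in C -> block_weight v = #|C|%:R^-1.
Proof. by move=> CP vC; rewrite /block_weight (def_pblock triv CP vC). Qed.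

Lemma sum_block_weight : \sum_v block_weight v = #|P|%:R.
Proof.
rewrite sum_blocks -sum1_card natr_sum; apply: eq_bigr => C CP.
rewrite (eq_bigr (fun=> #|C|%:R^-1)); last by move=> v; apply: block_weightE.
by rewrite sumr_const -[_ *+ #|_|]mulr_natl mulfV // gt_eqF // block_card_gt0.
Qed.

Lemma eq_pblockE u v : (pblock P u == pblock P v) = (v \in pblock P u).
Proof. by rewrite eq_pblock // coverE inE. Qed.

Lemma min_inv_card_le : #|P|%:R * min_inv_card R P <= sum_inv_card R P.
Proof.
rewrite /sum_inv_card -sum1_card natr_sum mulr_suml.
apply: ler_sum => C CP; rewrite mul1r.
exact: bigmin_le_cond.
Qed.

Lemma min_inv_card_ge0 : 0 <= min_inv_card R P.
Proof. by rewrite le_bigmin // => C _; rewrite invr_ge0 ler0n. Qed.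

End Cover.

(** With [r] the ratio of minimum to sum and [k] the number of blocks, [k r <= 1] and [k >= 1] give
    [r <= 1]; hence [c k <= k r^2 / 4 <= r / 4 <= 1/4]. *)
Lemma scc_constant_bound (R : realType) (V : finType) (P : {set {set V}}) (c : R) :
  partition P [set: V] -> (0 < #|P|)%N ->
  c < 4^-1 * (min_inv_card R P / sum_inv_card R P) ^+ 2 ->
  c * #|P|%:R <= 4^-1.
Proof.
move=> partP P0 clt.
have k1 : 1 <= #|P|%:R :> R by rewrite ler1n.
have s0 : 0 < sum_inv_card R P.
  have /card_gt0P[C CP] := P0.
  rewrite /sum_inv_card (bigD1 C) //= ltr_pwDl ?invr_gt0 ?(block_card_gt0 partP) //.
  by apply: sumr_ge0 => D _; rewrite invr_ge0 ler0n.
set r := _ / _ in clt.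
have r0 : 0 <= r by rewrite divr_ge0 ?min_inv_card_ge0 // ltW.
have kr : #|P|%:R * r <= 1.
  by rewrite mulrA ler_pdivrMr // mul1r min_inv_card_le.
have r1 : r <= 1 by nra.
nra.
Qed.

(** * The lower bound on [t] for a feasible pair, and the case of equality *)

Section ThetaBound.
Context {R : realType} {V : finType} {e : rel V} {P : {set {set V}}}.
Context {c t : R} {a : V -> V -> R}.
Hypothesis coverP : clique_cover e P.
Hypothesis sym_e : symmetric e.
Hypothesis sccP : SCC e P c.
Hypothesis a_sym : forall i j, a i j = a j i.
Hypothesis a_diag : forall i, a i i = 0.
Hypothesis a_nonedge : forall i j, ~~ e i j -> a i j = 0.

Let M (i j : V) : R := t * (i == j)%:R + a i j - 1.
Hypothesis psdM : forall x : V -> R, 0 <= bform M x x.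

Let partP : partition P [set: V]. Proof. by case: coverP. Qed.
Let w : V -> R := block_weight P.

Let pb_mem v : pblock P v \in P.
Proof. by rewrite pblock_mem // (cover_partition partP) inE. Qed.

Definition gap (i j : V) : R := bform M (dirac_diff i j) (dirac_diff i j).

(** The term [j = i] is harmless: [dirac_diff i i] is the zero vector. *)
Definition block_gap (i : V) : R := \sum_(j in pblock P i) gap i j.

Lemma gap_ge0 i j : 0 <= gap i j.
Proof. exact: psdM. Qed.

Lemma block_gap_ge0 i : 0 <= block_gap i.
Proof. by apply: sumr_ge0 => j _; apply: gap_ge0. Qed.

Lemma gapE i j : gap i j = 2 * t * (1 - (i == j)%:R) - 2 * a i j.
Proof.
rewrite /gap bform_dirac_diff /M !eqxx !a_diag (a_sym j i) (eq_sym j i) /=.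
ring.
Qed.

(* If one of the three other pairs is an edge, the left-hand side is
   nonpositive; this avoids restricting the later average to valid pairs. *)
Lemma norm_cross_le i i' j j' : i \in pblock P i' -> j \in pblock P j' ->
  pblock P i != pblock P j ->
  `|a i j| * (1 - (e i j')%:R - (e i' j)%:R - (e i' j')%:R) <=
  2^-1 * (gap i i' + gap j j').
Proof.
move=> ii' jj' ij.
have gap0 := addr_ge0 (gap_ge0 i i') (gap_ge0 j j').
have rhs0 : 0 <= 2^-1 * (gap i i' + gap j j') by lra.
have neq_block u v : u \in pblock P i' -> v \in pblock P j' -> (u == v) = false.
  move=> ui vj; apply: contraNF ij => /eqP uv; subst v.
  move: ii' jj' ui vj; rewrite -!(eq_pblockE partP).
  by move=> /eqP <- /eqP <- /eqP -> /eqP ->.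
have i'i' : i' \in pblock P i' by rewrite -(eq_pblockE partP).
have j'j' : j' \in pblock P j' by rewrite -(eq_pblockE partP).
have a0 : 0 <= `|a i j| by [].
have [e1|/a_nonedge n1] := boolP (e i j').
  by case: (e i' j); case: (e i' j'); rewrite /=; nra.
have [e2|/a_nonedge n2] := boolP (e i' j).
  by case: (e i' j'); rewrite /=; nra.
have [e3|/a_nonedge n3] := boolP (e i' j'); first by rewrite /=; nra.
rewrite /= !subr0 mulr1.
(* In the mixed terms the constants [-1] cancel, the multiples of [t] vanish by [neq_block], and the
   three non-edges kill all entries but [a i j]. Taking [s = 1] and [s = -1] bounds it on both
   sides. *)
have cross (s : R) :
    bform M (fun u => dirac_diff i i' u + s * dirac_diff j j' u)
            (fun u => dirac_diff i i' u + s * dirac_diff j j' u) =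
    gap i i' + s * (2 * a i j) + s ^+ 2 * gap j j'.
  rewrite bform_line -!/(gap _ _) !bform_dirac_diff /M.
  rewrite !(eq_sym j) !(eq_sym j') !neq_block // (a_sym j i) (a_sym j i').
  rewrite (a_sym j' i) (a_sym j' i') n1 n2 n3 /=.
  by ring.
have := psdM (fun u => dirac_diff i i' u + 1 * dirac_diff j j' u).
have := psdM (fun u => dirac_diff i i' u + (-1) * dirac_diff j j' u).
rewrite !cross => pos1 pos2.
by rewrite ler_norml; apply/andP; split; lra.
Qed.

Lemma sum_cross_edges_le v C : C \in P -> v \notin C ->
  \sum_(u in C) (e v u)%:R <= c * #|C|%:R.
Proof.
move=> CP vC; apply: le_trans (sccP CP vC).
rewrite le_eqVlt; apply/orP; left; apply/eqP/esym.
rewrite -sum1_card natr_sum (eq_bigl (fun u => (u \in C) && e v u)) => [|u].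
  by rewrite big_mkcondr; apply: eq_bigr => u _; case: (e v u).
by rewrite inE.
Qed.

(** Sum [norm_cross_le] over all pairs in [X * Y]: each of the three edge indicators totals at most
    [c |X| |Y|], whence the factor [1 - 3c]. *)
Lemma norm_cross_weight_le i j : pblock P i != pblock P j ->
  (1 - 3 * c) * `|a i j| <= 2^-1 * (w i * block_gap i + w j * block_gap j).
Proof.
move=> ij.
set X := pblock P i; set Y := pblock P j.
have w0 k : 0 < w k by apply: block_weight_gt0.
have cw k : #|pblock P k|%:R * w k = 1 by apply: card_block_weight.
have iY : i \notin Y by rewrite -(eq_pblockE partP) eq_sym.
have jX : j \notin X by rewrite -(eq_pblockE partP).
pose T := \sum_(i' in X) \sum_(j' in Y)
   (1 - (e i j')%:R - (e i' j)%:R - (e i' j')%:R) : R.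
have leT : `|a i j| * T <=
    2^-1 * (#|Y|%:R * block_gap i + #|X|%:R * block_gap j).
  have -> : 2^-1 * (#|Y|%:R * block_gap i + #|X|%:R * block_gap j) =
    \sum_(i' in X) \sum_(j' in Y) 2^-1 * (gap i i' + gap j j').
    under eq_bigr do rewrite -mulr_sumr big_split sumr_const /=.
    by rewrite -mulr_sumr big_split /= sumr_const sumrMnl !mulr_natl.
  rewrite mulr_sumr; apply: ler_sum => i' iX; rewrite mulr_sumr.
  apply: ler_sum => j' jY; apply: norm_cross_le => //.
    by rewrite -(eq_pblockE partP) eq_sym (eq_pblockE partP).
  by rewrite -(eq_pblockE partP) eq_sym (eq_pblockE partP).
have geT : #|X|%:R * #|Y|%:R * (1 - 3 * c) <= T.
  have -> : T = \sum_(i' in X) \sum_(j' in Y) 1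
     - \sum_(i' in X) \sum_(j' in Y) (e i j')%:R
     - \sum_(i' in X) \sum_(j' in Y) (e i' j)%:R
     - \sum_(i' in X) \sum_(j' in Y) (e i' j')%:R.
    by rewrite -!sumrB; apply: eq_bigr => i' _; rewrite -!sumrB.
  have s1 : \sum_(i' in X) \sum_(j' in Y) 1 = #|X|%:R * #|Y|%:R :> R.
    by under eq_bigr do rewrite sumr_const; rewrite sumr_const mulr_natl.
  have s2 : \sum_(i' in X) \sum_(j' in Y) (e i j')%:R <= #|X|%:R * (c * #|Y|%:R).
    rewrite sumr_const -[X in X <= _]mulr_natl ler_wpM2l ?ler0n //.
    exact: (sum_cross_edges_le (pb_mem _)).
  have s3 : \sum_(i' in X) \sum_(j' in Y) (e i' j)%:R <= #|Y|%:R * (c * #|X|%:R).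
    rewrite exchange_big sumr_const -[X in X <= _]mulr_natl ler_wpM2l ?ler0n //.
    under eq_bigr do rewrite sym_e.
    exact: (sum_cross_edges_le (pb_mem _)).
  have s4 : \sum_(i' in X) \sum_(j' in Y) (e i' j')%:R <= #|X|%:R * (c * #|Y|%:R).
    rewrite mulr_natl -sumr_const; apply: ler_sum => i' iX.
    apply: (sum_cross_edges_le (pb_mem _)).
    move: iX; rewrite -!(eq_pblockE partP) -/Y /X => /eqP <-.
    by rewrite eq_sym.
  by rewrite s1; lra.
have le1 : `|a i j| * (#|X|%:R * #|Y|%:R * (1 - 3 * c)) <=
    2^-1 * (#|Y|%:R * block_gap i + #|X|%:R * block_gap j).
  by apply: le_trans leT; apply: ler_wpM2l.
(* Multiplying by [w i * w j] divides by [|X| |Y|] and turns the sums into averages. *)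
have ww0 : 0 <= w i * w j by rewrite mulr_ge0 // ltW.
have := ler_wpM2l ww0 le1.
have cwi := cw i; have cwj := cw j; rewrite -/X in cwi; rewrite -/Y in cwj.
have -> : w i * w j * (`|a i j| * (#|X|%:R * #|Y|%:R * (1 - 3 * c))) =
  (#|X|%:R * w i) * (#|Y|%:R * w j) * ((1 - 3 * c) * `|a i j|) by ring.
have -> : w i * w j * (2^-1 * (#|Y|%:R * block_gap i + #|X|%:R * block_gap j)) =
  2^-1 * ((#|Y|%:R * w j) * (w i * block_gap i)
     + (#|X|%:R * w i) * (w j * block_gap j)) by ring.
by rewrite cwi cwj !mul1r.
Qed.

(** The quantity [T] of the overview: the sum over the blocks of the mean gap of an ordered pair in
    the block. *)
Definition total_gap : R := \sum_i w i ^+ 2 * block_gap i.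

(** The cross term [X] of the overview, taken over ordered pairs. *)
Definition cross_sum : R :=
  \sum_i \sum_(j | pblock P i != pblock P j) w i * w j * a i j.

Lemma total_gap_ge0 : 0 <= total_gap.
Proof.
by apply: sumr_ge0 => i _; rewrite mulr_ge0 ?sqr_ge0 ?block_gap_ge0.
Qed.

(** Only edges contribute, and each is bounded by [norm_cross_weight_le]. For fixed [i], the weights
    [w j] of the cross neighbours of [i] total at most [c] in each block, hence [c k] overall. The
    bound [c <= 1/3] allows [a i j] to be replaced by its absolute value. *)
Lemma cross_sum_le : 0 <= c -> c <= 3^-1 ->
  (1 - 3 * c) * cross_sum <= c * #|P|%:R * total_gap.
Proof.
move=> c0 c3.
have w0 k : 0 < w k by apply: block_weight_gt0.
(* The share of the bound for the edge [ij] that is charged to [i]. *)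
pose F i j : R := (e i j)%:R * (w i ^+ 2 * block_gap i * w j).
have step : (1 - 3 * c) * cross_sum <=
    \sum_i \sum_(j | pblock P i != pblock P j) 2^-1 * (F i j + F j i).
  rewrite /cross_sum mulr_sumr; apply: ler_sum => i _.
  rewrite mulr_sumr; apply: ler_sum => j ij; rewrite /F (sym_e j i).
  have [eij|/a_nonedge ->] := boolP (e i j); last by rewrite !mulr0 /=; lra.
  have ww0 : 0 <= w i * w j by rewrite mulr_ge0 // ltW.
  have := ler_wpM2l ww0 (norm_cross_weight_le ij).
  have : (1 - 3 * c) * (w i * w j * a i j) <= (1 - 3 * c) * (w i * w j * `|a i j|).
    by rewrite ler_wpM2l ?ler_wpM2l ?ler_norm //; lra.
  by move=> le1 le2; apply: le_trans le1 _; rewrite /= !mul1r; lra.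
apply: le_trans step _.
(* The range is symmetric in [i] and [j], so both halves have the same sum. *)
have -> : \sum_i \sum_(j | pblock P i != pblock P j) 2^-1 * (F i j + F j i) =
    \sum_i \sum_(j | pblock P i != pblock P j) F i j.
  under eq_bigr do rewrite -mulr_sumr big_split /=.
  rewrite -mulr_sumr big_split /=.
  rewrite [X in _ + X](exchange_big_dep predT) //=.
  under [X in _ + X]eq_bigr do under eq_bigl do rewrite eq_sym.
  by lra.
rewrite /total_gap mulr_sumr; apply: ler_sum => i _.
rewrite /F; under eq_bigr do rewrite mulrCA.
rewrite -mulr_sumr [leRHS]mulrC.
apply: ler_wpM2l; first by rewrite mulr_ge0 ?sqr_ge0 ?block_gap_ge0.
rewrite big_mkcond (sum_blocks partP) /=.
rewrite mulr_natr -sumr_const; apply: ler_sum => C CP.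
(* The block of [i] itself contributes 0, which is at most [c] because [0 <= c]. *)
have [iC|iC] := boolP (i \in C).
  rewrite big1 // => j jC.
  by rewrite !(def_pblock (partition_trivIset partP) CP) // eqxx.
rewrite (eq_bigr (fun j => #|C|%:R^-1 * (e i j)%:R)); last first.
  move=> j jC; rewrite -(block_weightE partP CP jC) mulrC ifT //.
  apply: contraNneq iC => ij.
  rewrite -(def_pblock (partition_trivIset partP) CP jC) -ij.
  by rewrite mem_pblock (cover_partition partP) inE.
rewrite -mulr_sumr mulrC ler_pdivrMr ?(block_card_gt0 partP) //.
exact: sum_cross_edges_le.
Qed.

(** The form is evaluated at [w]. This vector is chosen because its block sums are equal, so the
    form of the pair [(Astar, k)] vanishes there and nothing is lost at the optimum. *)
Lemma total_gap_cross_sum :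
  0 <= t * #|P|%:R - #|P|%:R ^+ 2 - 2^-1 * total_gap + cross_sum.
Proof.
have := psdM w.
suff -> : bform M w w =
  t * #|P|%:R - #|P|%:R ^+ 2 - 2^-1 * total_gap + cross_sum by [].
have rowE i : \sum_j w i * M i j * w j =
   t * w i - w i * #|P|%:R - 2^-1 * (w i ^+ 2 * block_gap i)
   + \sum_(j | pblock P i != pblock P j) w i * w j * a i j.
  have in_block : \sum_(j | pblock P i == pblock P j) w i * w j * a i j =
     t * w i - t * w i ^+ 2 - 2^-1 * (w i ^+ 2 * block_gap i).
    (* Inside a block [w] is constant, and [gapE] is solved for [a i j]. The resulting
       [- t * w i ^+ 2] later cancels the diagonal of [t I]. *)
    rewrite (eq_bigr (fun j => w i ^+ 2 * (t - t * (i == j)%:R - 2^-1 * gap i j))).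
      rewrite (eq_bigl (mem (pblock P i))) => [|j]; last exact: (eq_pblockE partP).
      rewrite -mulr_sumr !sumrB -!mulr_sumr -/(block_gap i).
      have -> : \sum_(j in pblock P i) (i == j)%:R = 1 :> R.
        rewrite (bigD1 i) /=; last by rewrite -(eq_pblockE partP).
        rewrite eqxx big1 ?addr0 // => j /andP[_ /negPf].
        by rewrite eq_sym => ->.
      rewrite sumr_const -[t *+ _]mulr_natl.
      have cw : #|pblock P i|%:R * w i = 1 by apply: card_block_weight.
      have -> : t * w i = t * w i * (#|pblock P i|%:R * w i) by rewrite cw mulr1.
      by ring.
    move=> j /eqP ij; have -> : w j = w i by rewrite /w /block_weight ij.
    by rewrite gapE; field.
  have -> : \sum_j w i * M i j * w j =
     \sum_j (t * w i * (w j * (i == j)%:R)) + \sum_j w i * w j * a i j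
       - \sum_j w i * w j.
    by rewrite -big_split -sumrB; apply: eq_bigr => j _; rewrite /M /=; ring.
  rewrite (bigID (fun j => pblock P i == pblock P j) _ (fun j => w i * w j * a i j)).
  rewrite /= in_block -!mulr_sumr (sum_block_weight partP).
  rewrite (bigD1 i) //= eqxx mulr1 big1 ?addr0; first by ring.
  by move=> j /negPf; rewrite eq_sym => ->; rewrite mulr0.
rewrite /bform; under eq_bigr do rewrite rowE.
rewrite big_split !sumrB -!mulr_sumr -mulr_suml (sum_block_weight partP) /=.
by rewrite -/total_gap -/cross_sum expr2.
Qed.

(** As [1 - 3c >= 97/100], [cross_sum_le] gives [X <= (25/97) T], and [1/2 - 25/97 > 1/5]. *)
Lemma total_gap_bound : 0 <= c -> c <= 100^-1 -> c * #|P|%:R <= 4^-1 ->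
  5^-1 * total_gap <= t * #|P|%:R - #|P|%:R ^+ 2.
Proof.
move=> c0 c100 ck.
have c3 : c <= 3^-1 by lra.
have := cross_sum_le c0 c3; have := total_gap_cross_sum; have := total_gap_ge0.
set T := total_gap; set X := cross_sum => T0 pos le1.
have : c * #|P|%:R * T <= 4^-1 * T by rewrite ler_wpM2r.
by nra.
Qed.

(** A vanishing sum of nonnegative terms with positive weights makes every gap within a block zero,
    so [a i j = t] there off the diagonal. Across blocks [norm_cross_weight_le] then forces
    [a i j = 0], since [1 - 3c > 0]. *)
Lemma total_gap0_eq : c <= 100^-1 -> total_gap = 0 ->
  forall i j, a i j = t * ((pblock P i == pblock P j)%:R - (i == j)%:R).
Proof.
move=> c100 /eqP; rewrite psumr_eq0 => [/allP gap0|i _]; last first.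
  by rewrite mulr_ge0 ?sqr_ge0 ?block_gap_ge0.
have bgap0 i : block_gap i = 0.
  have /implyP/(_ isT) := gap0 i (mem_index_enum i).
  by rewrite mulf_eq0 sqrf_eq0 gt_eqF ?(block_weight_gt0 partP) //= => /eqP.
move=> i j; have [ij|ij] := eqVneq (pblock P i) (pblock P j).
  have /eqP := bgap0 i; rewrite psumr_eq0 => [/allP gap1|k _]; last exact: gap_ge0.
  have /implyP/(_ _)/eqP := gap1 j (mem_index_enum j).
  by rewrite -(eq_pblockE partP) ij eqxx gapE => /(_ isT) /=; lra.
have -> : (i == j) = false by apply: contraNF ij => /eqP ->.
have := norm_cross_weight_le ij; rewrite !bgap0 !mulr0 addr0 mulr0 subrr mulr0.
have := normr_ge0 (a i j) => n0 le0.
by apply/eqP; rewrite -normr_eq0; apply/eqP; nra.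
Qed.

End ThetaBound.

(** * Feasibility of [Astar] with value [k] *)

Section AstarFeasible.
Context {R : realType} {V : finType} {e : rel V} {P : {set {set V}}}.
Hypothesis coverP : clique_cover e P.

Let partP : partition P [set: V]. Proof. by case: coverP. Qed.

Lemma AstarE i j : Astar R P (enum_rank i) (enum_rank j) =
  #|P|%:R * ((pblock P i == pblock P j)%:R - (i == j)%:R).
Proof.
rewrite /Astar !mxE summxE (inj_eq enum_rank_inj) mulrBr -[_ *+ (i == j)]mulr_natr.
congr (_ - _).
have iP : pblock P i \in P by rewrite pblock_mem // (cover_partition partP) inE.
rewrite (bigD1 (pblock P i)) //= !mxE big_ord1 !mxE !enum_rankK.
rewrite mem_pblock (cover_partition partP) inE mul1r (eq_pblockE partP).
rewrite big1 ?addr0 // => C /andP[CP Ci].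
rewrite !mxE big_ord1 !mxE !enum_rankK.
have [iC|_] := boolP (i \in C); last by rewrite mul0r mulr0.
by rewrite (def_pblock (partition_trivIset partP) CP iC) eqxx in Ci.
Qed.

Lemma Astar_sym : (Astar R P)^T = Astar R P.
Proof.
apply/matrixP => i j; rewrite mxE -(enum_valK i) -(enum_valK j) !AstarE.
by rewrite eq_sym [enum_val j == _]eq_sym.
Qed.

(** This is the form of [k I + Astar - J]. It depends on [x] only through the block sums [s C], and
    the claim is Cauchy-Schwarz for these [k] numbers. *)
Lemma block_form_ge0 (x : V -> R) : (0 < #|P|)%N ->
  0 <= bform (fun u v => #|P|%:R * (pblock P u == pblock P v)%:R - 1) x x.
Proof.
move=> P0; have k0 : 0 < #|P|%:R :> R by rewrite ltr0n.
pose s (C : {set V}) : R := \sum_(v in C) x v; pose S := \sum_v x v.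
have -> : bform (fun u v => #|P|%:R * (pblock P u == pblock P v)%:R - 1) x x =
   #|P|%:R * (\sum_(C in P) s C ^+ 2) - S ^+ 2.
  have rowE u : \sum_v x u * (#|P|%:R * (pblock P u == pblock P v)%:R - 1) * x v =
      x u * (#|P|%:R * s (pblock P u)) - x u * S.
    have -> : s (pblock P u) = \sum_v (pblock P u == pblock P v)%:R * x v.
      rewrite /s big_mkcond; apply: eq_bigr => v _; rewrite (eq_pblockE partP).
      by case: ifP; rewrite ?mul1r ?mul0r.
    rewrite -mulrBr /S mulr_sumr -sumrB mulr_sumr; apply: eq_bigr => v _; ring.
  rewrite /bform; under eq_bigr do rewrite rowE.
  rewrite sumrB -mulr_suml -/S -expr2; congr (_ - _).
  rewrite mulr_sumr (sum_blocks partP); apply: eq_bigr => C CP.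
  rewrite expr2 mulrCA mulr_suml; apply: eq_bigr => u uC.
  by rewrite (def_pblock (partition_trivIset partP) CP uC).
have SE : S = \sum_(C in P) s C by rewrite /S (sum_blocks partP).
(* Expanded, this sum of squares is [k] times the form. *)
have : 0 <= \sum_(C in P) (#|P|%:R * s C - S) ^+ 2.
  by apply: sumr_ge0 => C _; apply: sqr_ge0.
rewrite (eq_bigr (fun C => #|P|%:R ^+ 2 * s C ^+ 2 - 2 * #|P|%:R * S * s C + S ^+ 2)).
  rewrite big_split sumrB -!mulr_sumr -SE sumr_const -[S *+ _]mulr_natl /=.
  by move=> sq0; rewrite -(pmulr_rge0 _ k0); lra.
by move=> C _; ring.
Qed.

Lemma Astar_feasible : simple_graph e -> (0 < #|P|)%N ->
  theta_feasible e #|P|%:R (Astar R P).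
Proof.
move=> [sym_e irr_e] P0; split.
- exact: Astar_sym.
- split; first by rewrite linearB linearD /= tr_scalar_mx Astar_sym trmx_const.
  move=> x; rewrite mulmx_bformE.
  have := block_form_ge0 (fun u => x (enum_rank u) 0) P0.
  congr (0 <= _); apply: eq_bigr => u _; apply: eq_bigr => v _.
  by congr (_ * _ * _); rewrite theta_mxE AstarE; ring.
- by move=> i; rewrite -(enum_valK i) AstarE !eqxx subrr mulr0.
move=> i j nij; rewrite -(enum_valK i) -(enum_valK j) AstarE.
(* Cliques give edges only between distinct vertices; on the diagonal the two indicators cancel. *)
have [ij|ij] := eqVneq (enum_val i) (enum_val j); first by rewrite ij eqxx subrr mulr0.
rewrite subr0; have [pij|] := eqVneq (pblock P (enum_val i)); last by rewrite mulr0.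
case: coverP => _ /(_ (pblock P (enum_val i))) clique.
case/negP: nij; apply: clique => //.
- by rewrite pblock_mem // (cover_partition partP) inE.
- by rewrite mem_pblock (cover_partition partP) inE.
by rewrite -(eq_pblockE partP) pij.
Qed.

End AstarFeasible.

(** * Optimality and uniqueness *)

Lemma feasible_gap_bound (R : realType) (V : finType) (e : rel V)
    (P : {set {set V}}) (c t : R) (A : 'M[R]_#|V|) :
  simple_graph e -> clique_cover e P -> SCC e P c -> (0 < #|P|)%N ->
  0 <= c -> c <= 100^-1 -> c * #|P|%:R <= 4^-1 -> theta_feasible e t A ->
  #|P|%:R <= t /\ (t = #|P|%:R -> A = Astar R P).
Proof.
move=> [sym_e _] coverP sccP P0 c0 c100 ck [symA psdA diagA zeroA].
pose a i j := A (enum_rank i) (enum_rank j).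
have a_sym i j : a i j = a j i by rewrite /a -[in LHS]symA mxE.
have a_diag i : a i i = 0 by apply: diagA.
have a_nonedge i j : ~~ e i j -> a i j = 0.
  by move=> nij; apply: zeroA; rewrite !enum_rankK.
have psdM (x : V -> R) :
    0 <= bform (fun i j => t * (i == j)%:R + a i j - 1) x x.
  have := psdmx_bform_ge0 x psdA; congr (0 <= _).
  apply: eq_bigr => u _; apply: eq_bigr => v _; congr (_ * _ * _).
  exact: theta_mxE.
have k0 : 0 < #|P|%:R :> R by rewrite ltr0n.
have := total_gap_bound coverP sym_e sccP a_sym a_diag a_nonedge psdM c0 c100 ck.
have T0 := total_gap_ge0 (P := P) psdM.
set T := total_gap in T0 * => bound; split.
  have : 0 <= #|P|%:R * (t - #|P|%:R) by lra.
  by rewrite pmulr_rge0 // subr_ge0.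
move=> tk; have T_eq0 : T = 0 by rewrite tk in bound; lra.
apply/matrixP => i j; rewrite -(enum_valK i) -(enum_valK j) (AstarE coverP) -tk.
exact: (total_gap0_eq coverP sym_e sccP a_sym a_diag a_nonedge psdM c100 T_eq0).
Qed.

Unset Implicit Arguments.
Set Strict Implicit.

Theorem mainTheorem2 (R : realType) (V : finType) (e : rel V)
    (P : {set {set V}}) (c : R)
    (V_nonempty : (0 < #|V|)%N)
    (eG : simple_graph e)
    (coverP : clique_cover e P)
    (sccP : SCC e P c)
    (c_lt : c < Num.min (4^-1 * (min_inv_card R P / sum_inv_card R P) ^+ 2)
                        (100^-1)) :
  theta_optimal e (#|P|%:R : R) (Astar R P) /\
  (forall (t : R) (A : 'M[R]_#|V|),
     theta_optimal e t A -> t = #|P|%:R /\ A = Astar R P).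
Proof.
have [partP _] := coverP.
have P0 : (0 < #|P|)%N.
  have /card_gt0P[v _] := V_nonempty.
  apply/card_gt0P; exists (pblock P v).
  by rewrite pblock_mem // (cover_partition partP) inE.
move: c_lt; rewrite lt_min => /andP[/(scc_constant_bound partP P0) ck c100].
(* The bound on the gap needs [0 <= c], which may fail when [P] has one block. *)
pose c' := Num.max c 0.
have scc' : SCC e P c'.
  move=> v C CP vC; apply: le_trans (sccP v C CP vC) _.
  by rewrite ler_wpM2r ?le_max ?lexx ?ler0n.
have c'0 : 0 <= c' by rewrite le_max lexx orbT.
have c'100 : c' <= 100^-1 by rewrite ge_max (ltW c100); lra.
have c'k : c' * #|P|%:R <= 4^-1.
  by rewrite /c'; case: (leP c 0) => _ //; rewrite mul0r; lra.
have bound t A := @feasible_gap_bound R V e P c' t A eG coverP scc' P0 c'0 c'100 c'k.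
have feasA := @Astar_feasible R _ _ _ coverP eG P0.
split; first by split=> // t A /bound[].
move=> t A [feas opt]; have [kt uniq] := bound t A feas.
(* The upper bound on [t] comes from comparing the optimal pair with the feasible [Astar]. *)
have tk : t = #|P|%:R by apply/eqP; rewrite eq_le kt (opt _ _ feasA).
by split=> //; apply: uniq.
Qed.
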